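(* Let $(G,V)$ be a multiplicity free space with a one-dimensional quotient. We have $I(M)=\mathbb{C}[A]^{W_0}h(E)$ and $$\mathbb{C}[A]^{W_0}=\mathbb{C}[A]^{W_0,\tau}\oplus I(M).$$
   Context: Let $G$ be a connected reductive algebraic group over $\mathbb{C}$, $G'=[G,G]$, $V$ a finite-dimensional rational representation. $G$ acts on $\mathbb{C}[V]$ by $(g.\varphi)(x)=\varphi(g^{-1}x)$ and on $D(V)$ (differential operators on $V$ with polynomial coefficients) by conjugation. $(G,V)$ is multiplicity free if each irreducible representation of $G$ occurs at most once in $\mathbb{C}[V]$; it has a one-dimensional quotient if there is a homogeneous polynomial $\Delta_0\notin\mathbb{C}[V]^G$ with $\mathbb{C}[V]^{G'}=\mathbb{C}[\Delta_0]$. Fix a Borel subgroup $B$ of $G$ with Lie algebra $\mathfrak{b}$ and a Cartan subalgebra $\mathfrak{t}\subset\mathfrak{b}$ of $\mathfrak{g}=\mathrm{Lie}(G)$; $B$ has an open orbit in $V$. Let $\Delta_0,\dots,\Delta_r$ be the fundamental relative invariants of $(B,V)$ (irreducible $B$-relatively invariant polynomials, unique up to scalars, such that every rational relative invariant of $B$ is uniquely $c\Delta_0^{a_0}\cdots\Delta_r^{a_r}$, $c\in\mathbb{C}^*$, $a_i\in\mathbb{Z}$); $\Delta_0$ is the only one relatively invariant under $G$. Let $d_i=\deg\Delta_i$ and let $\lambda_i\in\mathfrak{t}^*$ be the infinitesimal character of $\Delta_i$ (the derivative of $\chi_i$, where $\Delta_i(b.x)=\chi_i(b)\Delta_i(x)$).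 Let $W$ be the Weyl group of $(\mathfrak{g},\mathfrak{t})$, $\rho$ the half-sum of the positive roots (those in $\mathfrak{b}$), $\mathfrak{a}^*=\bigoplus_{i=0}^r\mathbb{C}\lambda_i\subset\mathfrak{t}^*$, $A=\mathfrak{a}^*+\rho\subset\mathfrak{t}^*$, and $\mathbb{C}[A]$ the algebra of polynomial functions on the affine space $A$. For $\mathbf{a}\in\mathbb{N}^{r+1}$ let $V_{\mathbf{a}}$ be the irreducible $G$-submodule of $\mathbb{C}[V]$ generated by $\Delta_0^{a_0}\cdots\Delta_r^{a_r}$. Each $D\in D(V)^G$ acts on $V_{\mathbf{a}}$ by a scalar $b_D(\mathbf{a})$, polynomial in $\mathbf{a}$; for $\lambda=\sum a_i\lambda_i\in\mathfrak{a}^*$ put $b_D(\lambda)=b_D(a_0,\dots,a_r)$. Define $h:D(V)^G\to\mathbb{C}[A]$ by $h(D)(-\lambda+\rho)=b_D(\lambda)$. By a theorem of Knop, there is a finite subgroup $W_0$ (the little Weyl group) of the stabilizer of $A$ in $W$ such that $h$ is an isomorphism of $D(V)^G$ onto $\mathbb{C}[A]^{W_0}$; fix it. The algebra $\mathbb{C}[A]^{W_0}$ is stable under $\tau$, $\tau(P)(\lambda+\rho)=P((\lambda-\lambda_0)+\rho)$ ($\lambda\in\mathfrak{a}^*$); $\mathbb{C}[A]^{W_0,\tau}$ denotes the set of $\tau$-invariant elements of $\mathbb{C}[A]^{W_0}$. $E$ is the Euler operator on $V$, so $h(E)(-\lambda+\rho)=\mu(\lambda)$, where $\mu(a_0\lambda_0+\dots+a_r\lambda_r)=\sum_{i=0}^ra_id_i$.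 Put $\mathcal{M}=\{\lambda\in\mathfrak{a}^*:\mu(\lambda)=0\}$, $M=\mathcal{M}+\rho\subset A$ (which is $W_0$-stable), and $I(M)=\{P\in\mathbb{C}[A]^{W_0}:P|_M=0\}$. *)

(* Defs.v *)
From HB Require Import structures.
From mathcomp Require Import all_boot all_order all_algebra.
From mathcomp Require Import complex freeg mpoly.
From mathcomp Require Import mathcomp_extra boolp classical_sets functions.
From mathcomp Require Import cardinality fsbigop reals.

Set Implicit Arguments.
Unset Strict Implicit.
Unset Printing Implicit Defensive.

Import Order.TTheory GRing.Theory Num.Theory.

Local Open Scope classical_set_scope.
Local Open Scope ring_scope.
Local Open Scope complex_scope.

(* Algebraic groups are Zariski closed subgroups of GL_m(C), given as sets of
   m x m matrices; a polynomial in the entries is an element of C[m * m],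
   evaluated along mxvec. *)

Section LinearAlgebraicGroups.
Variables (R : realType) (m : nat).
Local Notation C := R[i].
Implicit Types (G H K N B Z : set 'M[C]_m) (g : 'M[C]_m).

Definition eval_mx (p : {mpoly C[m * m]}) g : C :=
  p.@[fun k => mxvec g ord0 k].

Definition zariski_closed Z : Prop :=
  exists S : set {mpoly C[m * m]},
    Z = [set g | g \in unitmx /\ forall p, S p -> eval_mx p g = 0].

Definition subgroup H : Prop :=
  [/\ forall g, H g -> g \in unitmx,
      H 1%:M,
      forall g h, H g -> H h -> H (g *m h)
    & forall g, H g -> H (invmx g)].

Definition algebraic_group H : Prop := subgroup H /\ zariski_closed H.

Definition zariski_connected Z : Prop :=
  forall Z1 Z2, zariski_closed Z1 -> zariski_closed Z2 ->
    Z1 `|` Z2 = Z -> Z1 `&` Z2 = set0 -> Z1 = set0 \/ Z2 = set0.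

Definition normal_in N G : Prop :=
  N `<=` G /\ forall g h, G g -> N h -> N (g *m h *m invmx g).

Definition unipotent N : Prop :=
  forall g, N g -> exists k : nat, (g - 1%:M) ^+ k = 0.

(* The unipotent radical is trivial. *)
Definition reductive G : Prop :=
  forall N, algebraic_group N -> zariski_connected N -> normal_in N G ->
    unipotent N -> N = [set 1%:M].

(* The abstract subgroup generated by the commutators. *)
Definition derived_subgroup H : set 'M[C]_m :=
  [set g | forall K, subgroup K ->
     (forall x y, H x -> H y -> K (x *m y *m invmx x *m invmx y)) -> K g].

Definition solvable_group H : Prop :=
  exists k : nat, iter k derived_subgroup H = [set 1%:M].

Definition connected_solvable H : Prop :=
  [/\ algebraic_group H, zariski_connected H & solvable_group H].

Definition borel_subgroup G B : Prop :=
  [/\ B `<=` G, connected_solvable B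
    & forall H, H `<=` G -> connected_solvable H -> B `<=` H -> H = B].

(* Regular functions on GL_m are the p / det ^ k. *)
Definition regular_expr G (f : 'M[C]_m -> C) (p : {mpoly C[m * m]}) (k : nat) :=
  forall g, G g -> f g = eval_mx p g / (\det g) ^+ k.

Definition regular_on G (f : 'M[C]_m -> C) : Prop :=
  exists p k, regular_expr G f p k.

Definition rational_rep G (n : nat) (sigma : 'M[C]_m -> 'M[C]_n) : Prop :=
  [/\ sigma 1%:M = 1%:M,
      forall g h, G g -> G h -> sigma (g *m h) = sigma g *m sigma h
    & forall i j, regular_on G (fun g => sigma g i j)].

(* Derivative of p at the identity in the direction X. *)
Definition deriv_at1 (p : {mpoly C[m * m]}) (X : 'M[C]_m) : C :=
  \sum_k eval_mx p^`M(k) 1%:M * mxvec X ord0 k.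

(* Lie(G) as the Zariski tangent space of G at 1, inside gl_m. *)
Definition lie_algebra G : set 'M[C]_m :=
  [set X | forall p, (forall g, G g -> eval_mx p g = 0) -> deriv_at1 p X = 0].

Definition lie (X Y : 'M[C]_m) : 'M[C]_m := X *m Y - Y *m X.

Definition cartan_subalgebra (gg : set 'M[C]_m) (t : {vspace 'M[C]_m}) : Prop :=
  [/\ forall X, X \in t -> gg X,
      forall X Y, X \in t -> Y \in t -> lie X Y \in t,
      exists k : nat, forall (s : seq 'M[C]_m) Y, size s = k ->
        {subset s <= t} -> Y \in t -> foldr lie Y s = 0
    & forall X, gg X -> (forall Y, Y \in t -> lie X Y \in t) -> X \in t].

End LinearAlgebraicGroups.

Definition tdual (R : realType) (m : nat) (t : {vspace 'M[R[i]]_m}) :=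
  'Hom(subvs_of t, R[i]^o).

Section RootsAndWeyl.
Variables (R : realType) (m : nat) (G B : set 'M[R[i]]_m).
Variable t : {vspace 'M[R[i]]_m}.
Local Notation C := R[i].
Local Notation tdual := (tdual t).
Implicit Types (alpha : tdual) (H : subvs_of t).

Definition root_space alpha : set 'M[C]_m :=
  [set X | lie_algebra G X /\
     forall H, lie (vsval H) X = (alpha H : C) *: X].

Definition is_root alpha : Prop :=
  alpha != 0 /\ exists2 X, root_space alpha X & X != 0.

Definition is_positive_root alpha : Prop :=
  is_root alpha /\ root_space alpha `<=` lie_algebra B.

Definition half_sum_positive : tdual :=
  (2%:R^-1 : C) *: \sum_(alpha \in [set al | is_positive_root al]) alpha.

(* Root spaces are lines in the reductive case, so that one bracket suffices
   to describe [g_alpha, g_(-alpha)]. *)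
Definition is_coroot alpha H : Prop :=
  (exists X Y, [/\ root_space alpha X, root_space (- alpha) Y
                 & vsval H = lie X Y])
  /\ alpha H = 2%:R.

Inductive weyl_group : set 'End(tdual) :=
| weyl_one : weyl_group \1%VF
| weyl_refl alpha H (s w : 'End(tdual)) :
    is_root alpha -> is_coroot alpha H ->
    (forall lam : tdual, s lam = lam - (lam H : C) *: alpha) ->
    weyl_group w -> weyl_group (s \o w)%VF.

(* chi' on t at the identity, for chi = p / det ^ k on B. *)
Definition is_inf_character (chi : 'M[C]_m -> C) (lam : tdual) : Prop :=
  exists p k, regular_expr B chi p k /\
    forall H, lam H = deriv_at1 p (vsval H)
                      - k%:R * \tr (vsval H) * eval_mx p 1%:M.

Definition subgroup_End (W0 : set 'End(tdual)) : Prop :=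
  [/\ W0 \1%VF,
      forall u v, W0 u -> W0 v -> W0 (u \o v)%VF
    & forall u, W0 u -> W0 (u^-1)%VF].

End RootsAndWeyl.

(* V is C^n (column vectors), C[V] is {mpoly C[n]}, pi : G -> GL(V). *)

Section Representation.
Variables (R : realType) (m n : nat) (G : set 'M[R[i]]_m).
Variable pi : 'M[R[i]]_m -> 'M[R[i]]_n.
Local Notation C := R[i].
Local Notation CV := {mpoly C[n]}.
Local Notation operator := (CV -> CV).
Implicit Types (H : set 'M[C]_m) (f phi : CV) (D : operator).

(* x |-> f (M x) *)
Definition subst_lin (M : 'M[C]_n) f : CV :=
  f \mPo [tuple \sum_j M i j *: 'X_j | i < n].

Definition act (g : 'M[C]_m) f : CV := subst_lin (pi (invmx g)) f.

Definition invariants H : set CV :=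
  [set f | forall g, H g -> act g f = f].

Definition subspace (E : lmodType C) (S : set E) : Prop :=
  S 0 /\ forall (c : C) u v, S u -> S v -> S (c *: u + v).

Definition irreducible_rep (k : nat) (sigma : 'M[C]_m -> 'M[C]_k) : Prop :=
  [/\ rational_rep G sigma, (0 < k)%N
    & forall S : set 'cV[C]_k, subspace S ->
        (forall g u, G g -> S u -> S (sigma g *m u)) ->
        S = [set 0] \/ S = setT].

Definition embedding (k : nat) (sigma : 'M[C]_m -> 'M[C]_k)
    (F : {linear 'cV[C]_k -> CV}) : Prop :=
  injective F /\ forall g u, G g -> F (sigma g *m u) = act g (F u).

(* At most one submodule of C[V] is isomorphic to a given irreducible
   representation. *)
Definition multiplicity_free : Prop :=
  forall (k : nat) (sigma : 'M[C]_m -> 'M[C]_k), irreducible_rep sigma ->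
    forall F1 F2 : {linear 'cV[C]_k -> CV},
      embedding sigma F1 -> embedding sigma F2 -> range F1 = range F2.

Definition one_dim_quotient : Prop :=
  exists delta : CV,
    [/\ exists d : nat, delta \is d.-homog,
        ~ invariants G delta
      & invariants (derived_subgroup G)
        = range (fun q : {poly C} => horner_alg delta q)].

Definition irreducible_mpoly f : Prop :=
  [/\ f != 0, f \isn't a GRing.unit
    & forall p q, f = p * q -> p \is a GRing.unit \/ q \is a GRing.unit].

Definition rel_invariant H (chi : 'M[C]_m -> C) f : Prop :=
  forall g, H g -> subst_lin (pi g) f = chi g *: f.

(* p / q is a nonzero rational relative invariant of character chi. *)
Definition rel_invariant_frac H (chi : 'M[C]_m -> C) (p q : CV) : Prop :=
  [/\ p != 0, q != 0
    & forall g, H g ->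
        subst_lin (pi g) p * q = chi g *: (p * subst_lin (pi g) q)].

Definition fundamental_rel_invariants B (r : nat)
    (Delta : 'I_r.+1 -> CV) (chi : 'I_r.+1 -> 'M[C]_m -> C) : Prop :=
  [/\ forall i, irreducible_mpoly (Delta i),
      forall i, rel_invariant B (chi i) (Delta i)
    & forall p q eta, rel_invariant_frac B eta p q ->
        exists! ca : C * {ffun 'I_r.+1 -> int},
          ca.1 != 0 /\
          (tofrac p / tofrac q : {fraction CV})
          = tofrac (ca.1%:MP) * \prod_i tofrac (Delta i) ^ ca.2 i].

Definition diff_op : set operator :=
  [set D | exists s : seq (CV * 'X_{1..n}),
     D = (fun phi => \sum_(pm <- s) pm.1 * phi^`M[pm.2])].

Definition diff_op_inv : set operator :=
  [set D | diff_op D /\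
     forall g, G g -> (fun phi => act g (D (act (invmx g) phi))) = D].

Definition euler : operator := fun phi => \sum_i 'X_i * phi^`M(i).

Definition generated_submodule f : set CV :=
  [set phi | forall S : set CV, subspace S ->
     (forall g u, G g -> S u -> S (act g u)) -> S f -> S phi].

Definition V_of (r : nat) (Delta : 'I_r.+1 -> CV) (a : 'I_r.+1 -> nat) :
    set CV :=
  generated_submodule (\prod_i Delta i ^+ a i).

(* b assigns to each invariant D the polynomial b_D. *)
Definition is_b_function (r : nat) (Delta : 'I_r.+1 -> CV)
    (b : operator -> {mpoly C[r.+1]}) : Prop :=
  forall D, diff_op_inv D -> forall a phi, V_of Delta a phi ->
    D phi = (b D).@[fun i => (a i)%:R] *: phi.

End Representation.

Section AffineSpaceA.
Variables (R : realType) (m n r : nat) (t : {vspace 'M[R[i]]_m}).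
Local Notation C := R[i].
Local Notation tdual := (tdual t).
Local Notation CV := {mpoly C[n]}.
Local Notation operator := (CV -> CV).
Variables (lam : (r.+1).-tuple tdual) (rho : tdual).

Definition Aspace := {x : tdual | x - rho \in <<lam>>%VS}.

Definition Aset : set tdual := [set x | x - rho \in <<lam>>%VS].

Definition lam0 : tdual := tnth lam ord0.

Lemma translateA_subproof (x : Aspace) :
  (sval x - lam0) - rho \in <<lam>>%VS.
Proof.
by rewrite addrAC rpredB ?(svalP x) // memv_span // mem_tnth.
Qed.

Definition translateA (x : Aspace) : Aspace :=
  exist _ (sval x - lam0) (translateA_subproof x).

(* The coordinates of x - rho on (lambda_0, ..., lambda_r). *)
Definition poly_fun : set (Aspace -> C) :=
  [set P | exists p : {mpoly C[r.+1]},
     forall x, P x = p.@[fun i => coord lam i (sval x - rho)]].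

Definition stabilizes_A (w : 'End(tdual)) : Prop := w @` Aset = Aset.

Definition poly_fun_inv (W0 : set 'End(tdual)) : set (Aspace -> C) :=
  [set P | poly_fun P /\
     forall w, W0 w -> forall x y : Aspace, sval y = w (sval x) -> P y = P x].

Definition tau (P : Aspace -> C) : Aspace -> C := P \o translateA.

Definition poly_fun_inv_tau (W0 : set 'End(tdual)) : set (Aspace -> C) :=
  [set P | poly_fun_inv W0 P /\ tau P = P].

(* x = - lambda + rho, with lambda = rho - x. *)
Definition h_of (b : operator -> {mpoly C[r.+1]}) (D : operator) :
    Aspace -> C :=
  fun x => (b D).@[fun i => coord lam i (rho - sval x)].

Definition algebra_isomorphism (S : set operator) (T : set (Aspace -> C))
    (h : operator -> Aspace -> C) : Prop :=
  [/\ set_bij S T h,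
      h id = (fun=> 1),
      forall (c : C) D1 D2, S D1 -> S D2 ->
        h (fun phi => c *: D1 phi + D2 phi)
        = (fun x => c * h D1 x + h D2 x)
    & forall D1 D2, S D1 -> S D2 -> h (D1 \o D2) = (fun x => h D1 x * h D2 x)].

Definition mu (Delta : 'I_r.+1 -> CV) (x : tdual) : C :=
  \sum_i coord lam i x * ((msize (Delta i)).-1)%:R.

(* M = {lambda in a^* | mu lambda = 0} + rho *)
Definition Mset (Delta : 'I_r.+1 -> CV) : set Aspace :=
  [set x | mu Delta (sval x - rho) = 0].

Definition ideal_M (W0 : set 'End(tdual)) (Delta : 'I_r.+1 -> CV) :
    set (Aspace -> C) :=
  [set P | poly_fun_inv W0 P /\ forall x, Mset Delta x -> P x = 0].

Definition direct_sum (S S1 S2 : set (Aspace -> C)) : Prop :=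
  S = [set P | exists P1 P2,
         [/\ S1 P1, S2 P2 & P = (fun x => P1 x + P2 x)]]
  /\ S1 `&` S2 = [set (fun=> 0)].

End AffineSpaceA.

Arguments weyl_group {R m} G t.
Arguments poly_fun {R m r t} lam rho.
Arguments poly_fun_inv {R m r t} lam rho W0.
Arguments poly_fun_inv_tau {R m r t} lam rho W0.
Arguments tau {R m r t lam rho} P.
Arguments h_of {R m n r t} lam rho b D.
Arguments Mset {R m n r t} lam rho Delta.
Arguments ideal_M {R m n r t} lam rho W0 Delta.

(* Main.v *)
Require Import Defs.
From HB Require Import structures.
From mathcomp Require Import all_boot all_order all_algebra.
From mathcomp Require Import complex freeg mpoly.
From mathcomp Require Import mathcomp_extra boolp classical_sets functions.
From mathcomp Require Import cardinality fsbigop reals.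
From mathcomp Require Import ring.

(* In the coordinates of A, h(E)(x) = - mu(x - rho): by [is_b_function], E acts
   on V_a by the degree of the leading monomial of the product of the
   Delta_i^a_i. Moreover W0 fixes lambda_0. Indeed Delta_0 has a character eta
   of G, which is regular, and the differential of eta kills the brackets of
   Lie(G), hence the coroots, so that the reflections of W fix lambda_0.

   Since mu(lambda_0) = d_0 <> 0, the projection q of A onto M along lambda_0
   is defined; it commutes with W0, as mu(x - rho) is W0-invariant by Knop's
   theorem and W0 fixes lambda_0. For P in C[A]^W0, P o q is tau-invariant and
   P - P o q is a multiple of h(E). If P vanishes on M, then P o q = 0 and the
   cofactor is W0-invariant, because this can be checked on the lines in
   direction lambda_0, where h(E) is a nonzero polynomial. Finally a
   tau-invariant polynomial is constant on these lines, all of which meet M. *)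

Set Implicit Arguments.
Unset Strict Implicit.
Unset Printing Implicit Defensive.

Import Order.TTheory GRing.Theory Num.Theory.

Local Open Scope classical_set_scope.
Local Open Scope ring_scope.
Local Open Scope complex_scope.

(** * Polynomials along lines and modulo a linear form *)

Section Polynomials.
Variables (n : nat) (C : comNzRingType).

(** Constants and variables generate the algebra, so identities between evaluations, substitutions
    and derivations need only be checked on them. *)
Lemma mpoly_subalg_ind (P : {mpoly C[n]} -> Prop) :
    (forall c, P c%:MP) -> (forall i, P 'X_i) ->
    (forall p q, P p -> P q -> P (p + q)) ->
    (forall p q, P p -> P q -> P (p * q)) ->
  forall p, P p.
Proof.
move=> PC PX PD PM; apply: mpolyind => [|c m p _ _ Pp].
  by rewrite -mpolyC0.
apply: (PD) => //; rewrite -mul_mpolyC; apply: (PM) => //.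
rewrite mpolyXE_id; apply: (big_ind P) => [||i _].
- by rewrite -mpolyC1.
- exact: (PM).
- elim: (m i) => [|k IHk]; first by rewrite expr0 -mpolyC1.
  by rewrite exprS; apply: (PM).
Qed.

Lemma meval_line (p : {mpoly C[n]}) (u v : 'I_n -> C) :
  exists q : {poly C}, forall s, q.[s] = p.@[fun i => u i + s * v i].
Proof.
elim/mpoly_subalg_ind: p => [c|i|p1 p2 [q1 h1] [q2 h2]|p1 p2 [q1 h1] [q2 h2]].
- by exists c%:P => s; rewrite hornerC mevalC.
- by exists ((u i)%:P + 'X * (v i)%:P) => s; rewrite !hornerE mevalXU.
- by exists (q1 + q2) => s; rewrite hornerD h1 h2 mevalD.
- by exists (q1 * q2) => s; rewrite hornerM h1 h2 mevalM.
Qed.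

(** For a linear form [l] with [l(c) = 1], this is composition with the projection onto the kernel
    of [l] along [c]. *)
Definition shear (l : {mpoly C[n]}) (c : 'I_n -> C) (p : {mpoly C[n]}) :
    {mpoly C[n]} :=
  p \mPo [tuple 'X_i - c i *: l | i < n].

Lemma meval_shear l c p v :
  (shear l c p).@[v] = p.@[fun i => v i - l.@[v] * c i].
Proof.
rewrite comp_mpoly_meval; apply: meval_eq => i.
by rewrite tnth_mktuple mevalB mevalXU mevalZ mulrC.
Qed.

(** The substitution replaces each variable by one congruent to it modulo [l]. *)
Lemma shear_congr l c p : exists q, p = shear l c p + l * q.
Proof.
rewrite /shear; elim/mpoly_subalg_ind: p
  => [a|i|p1 p2 [q1 h1] [q2 h2]|p1 p2 [q1 h1] [q2 h2]].
- by exists 0; rewrite comp_mpolyC mulr0 addr0.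
- exists (c i)%:MP; rewrite comp_mpolyXU -tnth_nth tnth_mktuple.
  by rewrite -mul_mpolyC [l * _]mulrC subrK.
- by exists (q1 + q2); rewrite comp_mpolyD {1}h1 {1}h2; ring.
- exists (q1 * p2 + (p1 \mPo [tuple 'X_i - c i *: l | i < n]) * q2).
  by rewrite rmorphM /= {1}h1 {1 3}h2; ring.
Qed.

End Polynomials.

(** * Polynomials determined by their values at natural numbers *)

Section NatZeros.
Variable C : numDomainType.

Lemma poly_nat_zeros (q : {poly C}) : (forall k : nat, q.[k%:R] = 0) -> q = 0.
Proof.
move=> q0; apply/eqP/negPn/negP => nq.
have := @max_poly_roots _ q [seq k%:R | k <- iota 0 (size q)] nq.
rewrite size_map size_iota ltnn => H; suff: false by [].
apply: H; first by apply/allP => x /mapP[k _ ->]; apply/rootP.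
rewrite map_inj_uniq ?iota_uniq // => i j /eqP; rewrite eqr_nat => /eqP //.
Qed.

(** Natural values are traded for arbitrary ones one coordinate at a time, by the one-variable case
    on a line parallel to an axis. *)
Lemma mpoly_nat_zeros n (p : {mpoly C[n]}) :
  (forall a : 'I_n -> nat, p.@[fun i => (a i)%:R] = 0) -> forall v, p.@[v] = 0.
Proof.
move=> p0 v.
(* [H k] allows arbitrary coordinates of index below [k]; the claim is the case [k = n]. *)
have H k : (k <= n)%N -> forall v : 'I_n -> C,
    (forall i : 'I_n, (k <= i)%N -> exists a : nat, v i = a%:R) -> p.@[v] = 0.
  elim: k => [_|k IHk ltkn] {}v vnat.
    have /choice[a va] : forall i, exists a : nat, v i = a%:R.
      by move=> i; apply: vnat.
    by rewrite -(p0 a); apply: meval_eq.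
  pose ik := Ordinal ltkn.
  have [q hq] := meval_line p (fun i => if i == ik then 0 else v i)
    (fun i => (i == ik)%:R).
  have q0 : q = 0.
    apply: poly_nat_zeros => j; rewrite hq; apply: IHk => [|i leki].
      exact: ltnW.
    case: (i =P ik) => [_|nik]; first by exists j; rewrite mulr1 add0r.
    rewrite mulr0 addr0; apply: vnat; rewrite ltn_neqAle leki andbT.
    by apply/eqP => e; apply: nik; apply: val_inj.
  have := hq (v ik); rewrite q0 horner0 => ->; apply: meval_eq => i.
  by case: (i =P ik) => [->|_]; rewrite ?mulr1 ?add0r // mulr0 addr0.
apply: (H n) => // i; rewrite leqNgt ltn_ord //.
Qed.

Lemma affine_cancel (a d : C) (q1 q2 : {poly C}) : d != 0 ->
    (forall s, (a + s * d) * q1.[s] = (a + s * d) * q2.[s]) ->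
  q1 = q2.
Proof.
move=> nd H; apply/eqP; rewrite -subr_eq0.
have /eqP : (a%:P + d *: 'X) * (q1 - q2) = 0.
  apply: poly_nat_zeros => k.
  by rewrite !hornerE [d * _]mulrC mulrBr H subrr.
(* The affine factor is nonzero, its coefficient of degree 1 being [d]. *)
rewrite mulf_eq0 => /orP[/eqP/(congr1 (fun p : {poly C} => p`_1))|//].
rewrite coefD coefC coefZ coefX mulr1 add0r coef0 => /eqP.
by rewrite (negPf nd).
Qed.

End NatZeros.

(** Used for [d_0 <> 0]: a nonzero polynomial of degree 0 is an invertible constant. *)
Lemma nonunit_degree_neq0 n (F : fieldType) (p : {mpoly F[n]}) :
  p != 0 -> p \isn't a GRing.unit -> (msize p).-1 != 0.
Proof.
move=> np; apply: contraNneq => sp.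
have /msize1_polyC pE : (msize p <= 1)%N by case: (msize p) sp => // k /= ->.
move: np; rewrite pE mpolyC_eq0 => nc.
by apply: rmorph_unit; rewrite unitfE.
Qed.

(** * Differentials of characters on brackets of tangent vectors *)

Section LieAlgebra.
Variables (C : fieldType) (m : nat).
Local Notation poly := {mpoly C[m * m]}.
Implicit Types (p q : poly) (g h X Y : 'M[C]_m).

(* [evalm], [deriv1], [tangent1], and further down [substl], [eulerop] and
   [regular], repeat definitions of Defs over an abstract field, to which they
   are convertible at [R[i]]: failing unification problems unfold the concrete
   structure of [R[i]] and take minutes. *)
Definition evalm p g : C := p.@[fun k => mxvec g ord0 k].

Definition deriv1 p X : C := \sum_k evalm p^`M(k) 1%:M * mxvec X ord0 k.

Definition tangent1 (G : set 'M[C]_m) X : Prop :=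
  forall p, (forall g, G g -> evalm p g = 0) -> deriv1 p X = 0.

Lemma evalmD p q g : evalm (p + q) g = evalm p g + evalm q g.
Proof. exact: mevalD. Qed.

Lemma evalmM p q g : evalm (p * q) g = evalm p g * evalm q g.
Proof. exact: mevalM. Qed.

Lemma evalmC c g : evalm (c%:MP : poly) g = c.
Proof. exact: mevalC. Qed.

Lemma evalmZ c p g : evalm (c *: p) g = c * evalm p g.
Proof. exact: mevalZ. Qed.

Lemma deriv1C c X : deriv1 (c%:MP : poly) X = 0.
Proof.
by rewrite /deriv1 big1 // => k _; rewrite mderivC /evalm meval0 mul0r.
Qed.

Lemma deriv1D p q X : deriv1 (p + q) X = deriv1 p X + deriv1 q X.
Proof.
rewrite /deriv1 -big_split; apply: eq_bigr => k _ /=.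
by rewrite mderivD evalmD mulrDl.
Qed.

Lemma deriv1M p q X : deriv1 (p * q) X =
  deriv1 p X * evalm q 1%:M + evalm p 1%:M * deriv1 q X.
Proof.
rewrite /deriv1 mulr_suml mulr_sumr -big_split; apply: eq_bigr => k _ /=.
by rewrite mderivM evalmD 2!evalmM mulrDl mulrAC mulrA.
Qed.

Lemma deriv1Z c p X : deriv1 (c *: p) X = c * deriv1 p X.
Proof.
by rewrite -mul_mpolyC deriv1M deriv1C mul0r add0r evalmC.
Qed.

Lemma mderivXU (k l : 'I_(m * m)) : ('X_k : poly)^`M(l) = (k == l)%:R%:MP.
Proof.
rewrite mderivX mnm1E; case: (k =P l) => [->|_].
  by rewrite -{1}[U_(l)%MM]add0m addmK mpolyX0 scale1r mpolyC1.
by rewrite scale0r mpolyC0.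
Qed.

Lemma deriv1XU k X : deriv1 ('X_k : poly) X = mxvec X ord0 k.
Proof.
rewrite /deriv1 (bigD1 k) //= mderivXU eqxx evalmC mul1r big1 ?addr0 //.
move=> l nlk; rewrite mderivXU evalmC.
by rewrite eq_sym (negPf nlk) mul0r.
Qed.

Lemma deriv1_sum (I : Type) (r : seq I) (F : I -> poly) X :
  deriv1 (\sum_(i <- r) F i) X = \sum_(i <- r) deriv1 (F i) X.
Proof.
elim: r => [|i r IHr]; last by rewrite !big_cons deriv1D IHr.
by rewrite !big_nil -mpolyC0 deriv1C.
Qed.

Lemma deriv1Mlie p X Y :
  deriv1 p (X *m Y - Y *m X) = deriv1 p (X *m Y) - deriv1 p (Y *m X).
Proof.
rewrite /deriv1 -sumrB; apply: eq_bigr => k _.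
by rewrite linearB -mulrBr; congr (_ * _); rewrite [LHS]mxE [in X in _ + X]mxE.
Qed.

(** This permits differentiating identities that hold only on [G]. *)
Lemma tangent1_eq (G : set 'M[C]_m) X p q : tangent1 G X ->
    (forall g, G g -> evalm p g = evalm q g) ->
  deriv1 p X = deriv1 q X.
Proof.
move=> GX pq; apply/eqP; rewrite -subr_eq0 -mulN1r -deriv1Z -deriv1D.
apply/eqP; apply: GX => g Gg.
by rewrite evalmD evalmZ pq // mulN1r subrr.
Qed.

Definition lin_form (A : 'M[C]_(m * m)) k : poly := \sum_l A l k *: 'X_l.

Lemma eval_lin_form A k g : evalm (lin_form A k) g = (mxvec g *m A) ord0 k.
Proof.
rewrite /evalm raddf_sum mxE; apply: eq_bigr => l _ /=.
by rewrite mevalZ mevalXU mulrC.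
Qed.

Lemma deriv_lin_form A k X : deriv1 (lin_form A k) X = (mxvec X *m A) ord0 k.
Proof.
rewrite deriv1_sum mxE; apply: eq_bigr => l _.
by rewrite deriv1Z deriv1XU mulrC.
Qed.

Definition left_translate g p : poly :=
  p \mPo [tuple lin_form (lin_mulmx g) k | k < m * m].

Lemma left_translateD g p q :
  left_translate g (p + q) = left_translate g p + left_translate g q.
Proof. exact: comp_mpolyD. Qed.

Lemma left_translateM g p q :
  left_translate g (p * q) = left_translate g p * left_translate g q.
Proof. by rewrite /left_translate rmorphM. Qed.

Lemma eval_left_translate g p h :
  evalm (left_translate g p) h = evalm p (g *m h).
Proof.
rewrite /evalm comp_mpoly_meval; apply: meval_eq => k.
by rewrite tnth_mktuple -/(evalm _ _) eval_lin_form mul_vec_lin.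
Qed.

(** The left-invariant vector field with value [Y] at the identity: at [g] it differentiates [p] in
    the direction [g Y]. *)
Definition left_invariant_field Y p : poly :=
  \sum_k p^`M(k) * lin_form (lin_mulmxr Y) k.

Lemma left_invariant_fieldD Y p q : left_invariant_field Y (p + q) =
  left_invariant_field Y p + left_invariant_field Y q.
Proof.
rewrite /left_invariant_field -big_split; apply: eq_bigr => k _ /=.
by rewrite mderivD mulrDl.
Qed.

Lemma left_invariant_fieldM Y p q : left_invariant_field Y (p * q) =
  left_invariant_field Y p * q + p * left_invariant_field Y q.
Proof.
rewrite /left_invariant_field mulr_suml mulr_sumr -big_split.
by apply: eq_bigr => k _ /=; rewrite mderivM; ring.
Qed.

Lemma deriv_left_translate g p Y :
  deriv1 (left_translate g p) Y = evalm (left_invariant_field Y p) g.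
Proof.
elim/mpoly_subalg_ind: p => [c|i|p1 p2 h1 h2|p1 p2 h1 h2].
- rewrite /left_translate comp_mpolyC deriv1C /left_invariant_field.
  by rewrite big1 => [|k _]; rewrite ?mderivC ?mul0r // /evalm meval0.
- rewrite /left_translate comp_mpolyXU -tnth_nth tnth_mktuple deriv_lin_form.
  rewrite mul_vec_lin /left_invariant_field (bigD1 i) //= big1 => [|k nki].
    by rewrite addr0 mderivXU eqxx mul1r eval_lin_form mul_vec_lin.
  by rewrite mderivXU eq_sym (negPf nki) mul0r.
- rewrite left_translateD deriv1D left_invariant_fieldD evalmD.
  exact: congr2 h1 h2.
- rewrite left_translateM deriv1M left_invariant_fieldM evalmD 2!evalmM.
  have e q : evalm (left_translate g q) 1%:M = evalm q g.
    by rewrite eval_left_translate mulmx1.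
  exact: congr2 (congr2 _ h1 (e p2)) (congr2 _ (e p1) h2).
Qed.

(** By the Leibniz rule: the double sum is the Hessian of [p] at the identity, and the last term
    comes from differentiating the coefficients [g Y] of the field. *)
Lemma deriv_left_invariant_field p X Y :
  deriv1 (left_invariant_field Y p) X =
  \sum_k \sum_l evalm p^`M(k)^`M(l) 1%:M * mxvec X ord0 l * mxvec Y ord0 k
  + deriv1 p (X *m Y).
Proof.
rewrite deriv1_sum -big_split; apply: eq_bigr => k _ /=.
rewrite deriv1M deriv_lin_form eval_lin_form !mul_vec_lin /= mul1mx.
by rewrite /deriv1 mulr_suml.
Qed.

(** The Hessian terms cancel by symmetry of second derivatives. *)
Lemma deriv1_lie p X Y : deriv1 p (X *m Y - Y *m X) =
  deriv1 (left_invariant_field Y p) X - deriv1 (left_invariant_field X p) Y.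
Proof.
rewrite !deriv_left_invariant_field deriv1Mlie exchange_big /=.
set s := \sum_j _; set s' := \sum_j _.
suff -> : s = s' by ring.
apply: eq_bigr => k _; apply: eq_bigr => l _.
by rewrite mderiv_comm mulrAC.
Qed.

(* Differentiating [p (g h) = p g p h] along [Y] in [h], then along [X] in [g],
   gives a right-hand side symmetric in [X] and [Y]. *)
Lemma deriv_multiplicative_lie (G : set 'M[C]_m) p X Y :
    (forall g h, G g -> G h -> evalm p (g *m h) = evalm p g * evalm p h) ->
  tangent1 G X -> tangent1 G Y -> deriv1 p (X *m Y - Y *m X) = 0.
Proof.
move=> pM.
have H Z W : tangent1 G Z -> tangent1 G W ->
    deriv1 (left_invariant_field W p) Z = deriv1 p W * deriv1 p Z.
  move=> GZ GW; rewrite -deriv1Z; apply: (tangent1_eq GZ) => g Gg.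
  rewrite -deriv_left_translate evalmZ mulrC -deriv1Z.
  apply: (tangent1_eq GW) => h Gh.
  by rewrite eval_left_translate evalmZ pM.
by move=> GX GY; rewrite deriv1_lie !H // mulrC subrr.
Qed.

Definition det_mpoly : poly := \det (\matrix_(i, j) 'X_(mxvec_index i j)).

Lemma eval_det_mpoly g : evalm det_mpoly g = \det g.
Proof.
rewrite /evalm /det_mpoly -det_map_mx; congr (\det _).
by apply/matrixP => i j; rewrite mxE mxE /= mevalXU mxvecE.
Qed.

(* The equality [q det^k = p det^l] on [H] reduces the claim to [p] and [det],
   which are multiplicative on [G]. *)
Lemma deriv_inf_character_lie (G H : set 'M[C]_m) (eta chi : 'M[C]_m -> C)
    p k q l X Y :
    (forall g, G g -> g \in unitmx) -> (forall g h, G g -> G h -> G (g *m h)) ->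
    H `<=` G -> H 1%:M -> (forall g, H g -> eta g = chi g) ->
    (forall g h, G g -> G h -> eta (g *m h) = eta g * eta h) -> eta 1%:M = 1 ->
    (forall g, G g -> eta g = evalm p g / \det g ^+ k) ->
    (forall g, H g -> chi g = evalm q g / \det g ^+ l) ->
    tangent1 G X -> tangent1 G Y -> tangent1 H (X *m Y - Y *m X) ->
  deriv1 q (X *m Y - Y *m X) = 0.
Proof.
move=> Gunit GM HG H1 etachi etaM eta1 pG qH GX GY HXY.
have det0 g : G g -> \det g != 0 by move/Gunit; rewrite unitmxE unitfE.
have pE g : G g -> evalm p g = eta g * \det g ^+ k.
  by move=> Gg; rewrite (pG _ Gg) divfK // expf_neq0 // det0.
have qE g : H g -> evalm q g = chi g * \det g ^+ l.
  by move=> Hg; rewrite (qH _ Hg) divfK // expf_neq0 // det0 //; apply: HG.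
have detX j g : evalm (det_mpoly ^+ j) g = \det g ^+ j.
  by rewrite /evalm rmorphXn /= -/(evalm _ _) eval_det_mpoly.
have dp : deriv1 p (X *m Y - Y *m X) = 0.
  apply: (deriv_multiplicative_lie (G := G)) => // g h Gg Gh.
  by rewrite !pE ?etaM ?det_mulmx ?exprMn //; [ring|exact: GM].
have ddet j : deriv1 (det_mpoly ^+ j) (X *m Y - Y *m X) = 0.
  apply: (deriv_multiplicative_lie (G := G)) => // g h _ _.
  by rewrite !detX det_mulmx exprMn.
have : deriv1 (q * det_mpoly ^+ k) (X *m Y - Y *m X) =
       deriv1 (p * det_mpoly ^+ l) (X *m Y - Y *m X).
  apply: (tangent1_eq HXY) => g Hg.
  by rewrite !evalmM !detX qE // pE ?etachi //; [ring|exact: HG].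
by rewrite !deriv1M dp !ddet !detX det1 !expr1n !mulr0 !mulr1 !addr0.
Qed.

End LieAlgebra.

(** * The Euler operator and linear substitutions *)

Section Euler.
Variables (C : fieldType) (n : nat).
Local Notation CV := {mpoly C[n]}.
Implicit Types (M N : 'M[C]_n) (f phi : CV).

Definition substl M f : CV := f \mPo [tuple \sum_j M i j *: 'X_j | i < n].

Definition eulerop f : CV := \sum_i 'X_i * f^`M(i).

Lemma substlXU M i : substl M 'X_i = \sum_j M i j *: 'X_j.
Proof. by rewrite /substl comp_mpolyXU -tnth_nth tnth_mktuple. Qed.

Lemma substlZ M c f : substl M (c *: f) = c *: substl M f.
Proof. exact: comp_mpolyZ. Qed.

Lemma substlD M f phi : substl M (f + phi) = substl M f + substl M phi.
Proof. exact: comp_mpolyD. Qed.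

Lemma substlM M f phi : substl M (f * phi) = substl M f * substl M phi.
Proof. by rewrite /substl rmorphM. Qed.

Lemma substlC M c : substl M c%:MP = c%:MP.
Proof. exact: comp_mpolyC. Qed.

Lemma substl_sum M (I : Type) (r : seq I) (F : I -> CV) :
  substl M (\sum_(i <- r) F i) = \sum_(i <- r) substl M (F i).
Proof. by rewrite /substl raddf_sum. Qed.

Lemma substl1 f : substl 1%:M f = f.
Proof.
elim/mpoly_subalg_ind: f => [c|i|p1 p2 h1 h2|p1 p2 h1 h2].
- exact: substlC.
- rewrite substlXU (bigD1 i) //= mxE eqxx scale1r big1 ?addr0 // => j nji.
  by rewrite mxE eq_sym (negPf nji) scale0r.
- by rewrite substlD h1 h2.
- by rewrite substlM h1 h2.
Qed.

(** Substitution is precomposition, hence reverses products. *)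
Lemma substl_comp M N f : substl M (substl N f) = substl (N *m M) f.
Proof.
elim/mpoly_subalg_ind: f => [c|i|p1 p2 h1 h2|p1 p2 h1 h2].
- by rewrite !substlC.
- rewrite !substlXU substl_sum.
  under eq_bigr do rewrite substlZ substlXU scaler_sumr.
  rewrite exchange_big; apply: eq_bigr => k _; rewrite mxE scaler_suml.
  by apply: eq_bigr => j _; rewrite scalerA.
- by rewrite !substlD h1 h2.
- by rewrite !substlM h1 h2.
Qed.

Lemma eulerC c : eulerop (c%:MP : CV) = 0.
Proof. by rewrite /eulerop big1 // => i _; rewrite mderivC mulr0. Qed.

Lemma eulerD f phi : eulerop (f + phi) = eulerop f + eulerop phi.
Proof.
rewrite /eulerop -big_split; apply: eq_bigr => i _ /=.
by rewrite mderivD mulrDr.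
Qed.

Lemma eulerM f phi : eulerop (f * phi) = eulerop f * phi + f * eulerop phi.
Proof.
rewrite /eulerop mulr_suml mulr_sumr -big_split; apply: eq_bigr => i _ /=.
by rewrite mderivM; ring.
Qed.

Lemma eulerZ c f : eulerop (c *: f) = c *: eulerop f.
Proof. by rewrite -!mul_mpolyC eulerM eulerC mul0r add0r. Qed.

Lemma euler_sum (I : Type) (r : seq I) (F : I -> CV) :
  eulerop (\sum_(i <- r) F i) = \sum_(i <- r) eulerop (F i).
Proof.
elim: r => [|i r IHr]; last by rewrite !big_cons eulerD IHr.
by rewrite !big_nil -mpolyC0 eulerC.
Qed.

Lemma eulerX (k : 'X_{1..n}) : eulerop ('X_[k] : CV) = (mdeg k)%:R *: 'X_[k].
Proof.
rewrite /eulerop mdegE natr_sum scaler_suml; apply: eq_bigr => i _.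
rewrite mderivX -scalerAr -mpolyXD; have [->|ki] := posnP (k i).
  by rewrite !scale0r.
rewrite addmC submK //; apply/mnm_lepP => j.
by rewrite mnm1E; case: eqP => [<-|].
Qed.

Lemma eulerXU i : eulerop ('X_i : CV) = 'X_i.
Proof. by rewrite eulerX mdeg1 scale1r. Qed.

Lemma mcoeff_euler f k : (eulerop f)@_k = (mdeg k)%:R * f@_k.
Proof.
elim/mpolyind: f => [|c j f _ _ IHf].
  by rewrite -mpolyC0 eulerC mpolyC0 mcoeff0 mulr0.
rewrite eulerD eulerZ eulerX !mcoeffD IHf !mcoeffZ mcoeffX mulrDr.
by case: (j =P k) => [->|_]; rewrite ?mulr0 // !mulr1 mulrC.
Qed.

(** The operator multiplies each monomial by its degree; compare the coefficients at the leading
    monomial. *)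
Lemma euler_eigenvalue f c : f != 0 -> eulerop f = c *: f ->
  c = (mdeg (mlead f))%:R.
Proof.
move=> nf /(congr1 (mcoeff (mlead f))); rewrite mcoeff_euler mcoeffZ.
by move/mulIf => -> //; rewrite mleadc_eq0.
Qed.

Lemma euler_prod_eigenvalue r (Delta : 'I_r -> CV) (a : 'I_r -> nat) c :
    (forall i, Delta i != 0) ->
    eulerop (\prod_i Delta i ^+ a i) = c *: \prod_i Delta i ^+ a i ->
  c = \sum_i (a i)%:R * (msize (Delta i)).-1%:R.
Proof.
move=> nD; have nDa i : Delta i ^+ a i != 0 by rewrite expf_neq0.
move/euler_eigenvalue => ->; last by apply/prodf_neq0 => i _; apply: nDa.
rewrite mlead_prod => [|i _ _]; last exact: nDa.
rewrite mdeg_sum natr_sum; apply: eq_bigr => i _.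
by rewrite mleadX // mdegMn -mlead_deg //= natrM mulrC.
Qed.

Lemma scaler_mpolyI f a b : f != 0 -> a *: f = b *: f -> a = b.
Proof.
move=> nf /(congr1 (mcoeff (mlead f))); rewrite !mcoeffZ.
by apply: mulIf; rewrite mleadc_eq0.
Qed.

(** The Euler operator is a derivation that fixes linear forms, and a linear substitution maps
    linear forms to linear forms. *)
Lemma euler_substl M f : eulerop (substl M f) = substl M (eulerop f).
Proof.
elim/mpoly_subalg_ind: f => [c|i|p1 p2 h1 h2|p1 p2 h1 h2].
- by rewrite substlC eulerC -mpolyC0 substlC.
- rewrite eulerXU substlXU euler_sum; apply: eq_bigr => j _.
  by rewrite eulerZ eulerXU.
- by rewrite substlD !eulerD h1 h2 substlD.
- by rewrite substlM !eulerM h1 h2 substlD !substlM.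
Qed.

End Euler.

(** * Regularity and multiplicativity of the character of a relative invariant *)

Section GroupAction.
Variables (C : fieldType) (m n : nat) (G : set 'M[C]_m).
Variable pi : 'M[C]_m -> 'M[C]_n.
Local Notation CV := {mpoly C[n]}.

Definition regular (f : 'M[C]_m -> C) : Prop :=
  exists p k, forall g, G g -> f g = evalm p g / \det g ^+ k.

Hypothesis Gunit : forall g, G g -> g \in unitmx.
Hypothesis GM : forall g h, G g -> G h -> G (g *m h).
Hypothesis G1 : G 1%:M.
Hypothesis pi1 : pi 1%:M = 1%:M.
Hypothesis piM : forall g h, G g -> G h -> pi (g *m h) = pi g *m pi h.
Hypothesis pi_regular : forall i j, regular (fun g => pi g i j).

Lemma regularC c : regular (fun=> c).
Proof. by exists c%:MP, 0 => g _; rewrite evalmC expr0 divr1. Qed.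

Lemma regularD (f1 f2 : 'M[C]_m -> C) : regular f1 -> regular f2 ->
  regular (fun g => f1 g + f2 g).
Proof.
move=> [p [k pk]] [q [l ql]].
exists (p * det_mpoly C m ^+ l + q * det_mpoly C m ^+ k), (k + l)%N => g Gg.
have dg j : \det g ^+ j != 0.
  by rewrite expf_neq0 //; move: (Gunit Gg); rewrite unitmxE unitfE.
have detX j : evalm (det_mpoly C m ^+ j) g = \det g ^+ j.
  by rewrite /evalm rmorphXn /= -/(evalm _ _) eval_det_mpoly.
by rewrite pk // ql // evalmD !evalmM !detX exprD addf_div.
Qed.

Lemma regularM (f1 f2 : 'M[C]_m -> C) : regular f1 -> regular f2 ->
  regular (fun g => f1 g * f2 g).
Proof.
move=> [p [k pk]] [q [l ql]]; exists (p * q), (k + l)%N => g Gg.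
by rewrite pk // ql // evalmM exprD mulf_div.
Qed.

Lemma regular_sum (I : Type) (r : seq I) (P : pred I) (F : I -> 'M[C]_m -> C) :
  (forall i, regular (F i)) ->
  regular (fun g => \sum_(i <- r | P i) F i g).
Proof.
move=> FG; elim: r => [|i r IHr].
  under eq_fun do rewrite big_nil; exact: regularC.
under eq_fun do rewrite big_cons; case: (P i) => //.
by apply: regularD.
Qed.

(** These coefficients are polynomials in the entries of [pi g], which are regular. *)
Lemma regular_mcoeff_subst f k :
  regular (fun g => (substl (pi g) f)@_k).
Proof.
elim/mpoly_subalg_ind: f k => [c|i|p1 p2 h1 h2|p1 p2 h1 h2] k.
- under eq_fun do rewrite substlC; exact: regularC.
- under eq_fun do rewrite substlXU raddf_sum.
  apply: regular_sum => j; under eq_fun do rewrite /= mcoeffZ.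
  by apply: regularM => //; apply: regularC.
- by under eq_fun do rewrite substlD mcoeffD; apply: regularD.
- under eq_fun do rewrite substlM mcoeffM.
  by apply: regular_sum => j; apply: regularM.
Qed.

Section Character.
Variables (eta : 'M[C]_m -> C) (f : CV).
Hypotheses (nf : f != 0) (feta : forall g, G g -> substl (pi g) f = eta g *: f).

Lemma character1 : eta 1%:M = 1.
Proof.
have := feta G1; rewrite pi1 substl1 -[LHS]scale1r.
by move/(scaler_mpolyI nf).
Qed.

Lemma characterM g h : G g -> G h -> eta (g *m h) = eta g * eta h.
Proof.
move=> Gg Gh.
have := feta (GM Gg Gh); rewrite piM // -substl_comp feta // substlZ.
by rewrite feta // scalerA => /(scaler_mpolyI nf).
Qed.

(** The character is read off at the leading monomial of [f], as the coefficient of the transform of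
    [f] divided by that of [f]. *)
Lemma regular_character : regular eta.
Proof.
have [p [k pk]] := regularM (regular_mcoeff_subst f (mlead f))
                     (regularC (mleadc f)^-1).
exists p, k => g Gg; rewrite -pk // feta // mcoeffZ mulfK //.
by rewrite mleadc_eq0.
Qed.

End Character.
End GroupAction.

(** * Invariance of the Euler operator, and the Weyl group action on lambda_0 *)

Section WeylGroup.
Variables (R : realType) (m n : nat) (G B : set 'M[R[i]]_m).
Variable pi : 'M[R[i]]_m -> 'M[R[i]]_n.
Variable t : {vspace 'M[R[i]]_m}.

Lemma diff_op_inv_euler : subgroup G -> rational_rep G pi ->
  diff_op_inv G pi (@euler R n).
Proof.
move=> [Gunit _ _ GV] [pi1 piM _]; split=> [|g Gg].
  exists [seq ('X_i, U_(i)%MM) | i <- enum 'I_n]; apply: funext => phi.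
  rewrite big_map big_enum; apply: eq_bigr => i _.
  by rewrite mderivmU1m.
apply: funext => phi; rewrite /act invmxK.
have /mulmx1C piK : pi (invmx g) *m pi g = 1%:M.
  by rewrite -piM ?mulVmx ?pi1 //; [exact: Gunit|exact: GV].
(* The Euler operator commutes with the substitution by [pi g], which then cancels against that by
   [pi (invmx g)]. *)
apply: etrans (congr1 (substl _) (euler_substl _ _)) _.
by apply: etrans (substl_comp _ _ _) _; rewrite piK; apply: substl1.
Qed.

(** A coroot is a bracket of elements of Lie(G) that lies in [t], hence in Lie(B), where [lam] is
    the differential of the restriction of [eta]. *)
Lemma inf_character_coroot0 (f : {mpoly R[i][n]}) (eta chi : 'M[R[i]]_m -> R[i])
    (lam alpha : tdual t) (H : subvs_of t) :
    subgroup G -> rational_rep G pi -> subgroup B -> B `<=` G ->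
    (forall X, X \in t -> lie_algebra B X) ->
    f != 0 -> rel_invariant pi G eta f -> rel_invariant pi B chi f ->
    is_inf_character B chi lam -> is_coroot G alpha H ->
  lam H = 0.
Proof.
move=> [Gunit G1 GM _] [pi1 piM pi_reg] [_ B1 _ _] BG tB nf Geta Bchi.
case=> q [l [ql lamE]] [[X [Y [[GX _] [GY _] HXY]]] _].
have [p [k pk]] := regular_character Gunit pi_reg nf Geta.
have tH : lie_algebra B (lie X Y) by rewrite -HXY; apply: tB; apply: subvsP.
have q0 : deriv_at1 q (lie X Y) = 0.
  apply: (deriv_inf_character_lie Gunit GM BG B1 _ _ _ pk ql GX GY tH).
  - move=> g Bg; have := Bchi _ Bg; rewrite Geta; last exact: BG.
    exact: scaler_mpolyI.
  - exact: (characterM GM piM nf Geta).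
  - exact: (character1 G1 pi1 nf Geta).
(* The contribution of the power of the determinant vanishes too, a commutator having trace 0. *)
rewrite lamE HXY q0 /lie linearB /= mxtrace_mulC subrr.
by rewrite mulr0 mul0r subr0.
Qed.

Lemma weyl_group_fix (x : tdual t) (w : 'End(tdual t)) :
    (forall alpha H, is_coroot G alpha H -> x H = 0) ->
  weyl_group G t w -> w x = x.
Proof.
move=> x0; elim=> [|alpha H s {}w _ Hc sE _ IHw]; first by rewrite id_lfunE.
by rewrite comp_lfunE IHw sE (x0 _ _ Hc) scale0r subr0.
Qed.

End WeylGroup.

(** With [e] = lambda_0, [d] = d_0 and [a] the height of a point, this says that the point and its
    translate by -lambda_0 have the same projection onto M. *)
Lemma translate_projE (F : fieldType) (V : lmodType F) (x e : V) (a d : F) :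
  d != 0 -> x - e + - ((a - d) / d) *: e = x + - (a / d) *: e.
Proof.
move=> nd; rewrite mulrBl divff // opprB scalerDl scale1r scaleNr addrA.
by rewrite subrK.
Qed.

(** * The projection onto M along lambda_0 and the decomposition *)

Section Affine.
Variables (R : realType) (m n r : nat) (t : {vspace 'M[R[i]]_m}).
Local Notation C := R[i].
Variables (lam : (r.+1).-tuple (tdual t)) (rho : tdual t).
Variables (W0 : set 'End(tdual t)) (Delta : 'I_r.+1 -> {mpoly C[n]}).
Local Notation A := (Aspace lam rho).
Local Notation d i := ((msize (Delta i)).-1%:R : C).
Local Notation l0 := (lam0 lam).
Hypotheses (lam_free : free lam) (d0 : d ord0 != 0).
Hypothesis W0_fix : forall w, W0 w -> w l0 = l0.

Definition coords (x : A) (i : 'I_r.+1) : C := coord lam i (sval x - rho).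

Definition height (x : A) : C := mu lam Delta (sval x - rho).

Hypothesis height_inv : forall w, W0 w -> forall x y : A,
  sval y = w (sval x) -> height y = height x.

Lemma shift_subproof (x : A) (s : C) : sval x + s *: l0 - rho \in <<lam>>%VS.
Proof.
rewrite addrAC; apply: rpredD; first exact: (svalP x).
by apply: rpredZ; rewrite memv_span // mem_tnth.
Qed.

Definition shift (x : A) (s : C) : A :=
  exist _ (sval x + s *: l0) (shift_subproof x s).

Lemma sval_shift x s : sval (shift x s) = sval x + s *: l0.
Proof. by []. Qed.

Lemma sval_translateA (x : A) : sval (translateA x) = sval x - l0.
Proof. by []. Qed.

(* The coordinates of lambda_0. *)
Definition unit0 (i : 'I_r.+1) : C := (i == ord0)%:R.

Lemma coords_shift x s i : coords (shift x s) i = coords x i + s * unit0 i.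
Proof.
rewrite /coords /= addrAC linearD linearZ /= /lam0 (tnth_nth 0) coord_free //.
by rewrite /unit0 eq_sym.
Qed.

Definition height_poly : {mpoly C[r.+1]} := \sum_i d i *: 'X_i.

Lemma heightE x : height x = height_poly.@[coords x].
Proof.
rewrite /height_poly raddf_sum; apply: eq_bigr => i _ /=.
by rewrite mevalZ mevalXU mulrC.
Qed.

Lemma height_shift x s : height (shift x s) = height x + s * d ord0.
Proof.
have H y : height y = \sum_i coords y i * d i by [].
rewrite !H; under eq_bigr do rewrite coords_shift mulrDl.
rewrite big_split (bigD1 ord0 (F := fun i => s * unit0 i * d i)) //=.
rewrite [X in _ + (_ + X)]big1 ?addr0 => [|i ni0]; first by rewrite mulr1.
by rewrite /unit0 (negPf ni0) mulr0 mul0r.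
Qed.

(* The projection of A onto M along lambda_0. *)
Definition proj (x : A) : A := shift x (- (height x / d ord0)).

Lemma proj_Mset x : Mset lam rho Delta (proj x).
Proof.
suff: height (proj x) = 0 by [].
by rewrite /proj height_shift mulNr divfK // subrr.
Qed.

(** Points of A carry membership proofs; this reduces their comparison to that of the underlying
    vectors. *)
Lemma poly_fun_eq (P : A -> C) (x y : A) : poly_fun lam rho P ->
  sval x = sval y -> P x = P y.
Proof. by case=> p pP xy; rewrite !pP xy. Qed.

Lemma poly_fun_line (P : A -> C) (x : A) : poly_fun lam rho P ->
  exists q : {poly C}, forall s, q.[s] = P (shift x s).
Proof.
case=> p pP; have [q qE] := meval_line p (coords x) unit0.
exists q => s; rewrite qE pP; apply: meval_eq => i.
by rewrite -coords_shift.
Qed.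

(** In coordinates the projection is the shear by the height along lambda_0 / d_0, a vector of
    height 1. *)
Lemma poly_fun_proj (P : A -> C) p : (forall x, P x = p.@[coords x]) ->
  forall x, P (proj x) =
    (shear height_poly (fun i => unit0 i / d ord0) p).@[coords x].
Proof.
move=> pP x; rewrite pP meval_shear; apply: meval_eq => i.
by rewrite coords_shift -heightE mulNr mulrAC mulrA.
Qed.

Lemma shift_inv w x y s : W0 w -> sval y = w (sval x) ->
  sval (shift y s) = w (sval (shift x s)).
Proof. by move=> Ww yx; rewrite /= yx linearD linearZ /= W0_fix. Qed.

Lemma proj_inv w x y : W0 w -> sval y = w (sval x) ->
  sval (proj y) = w (sval (proj x)).
Proof.
by move=> Ww yx; rewrite /proj (height_inv Ww yx); apply: shift_inv.
Qed.

Lemma poly_fun_invD (a : C) (P1 P2 : A -> C) : poly_fun_inv lam rho W0 P1 ->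
    poly_fun_inv lam rho W0 P2 ->
  poly_fun_inv lam rho W0 (fun x => P1 x + a * P2 x).
Proof.
move=> [[p1 pP1] P1i] [[p2 pP2] P2i]; split.
  by exists (p1 + a *: p2) => x; rewrite pP1 pP2 mevalD mevalZ.
by move=> w Ww x y yx; rewrite (P1i w Ww x y yx) (P2i w Ww x y yx).
Qed.

Lemma ideal_M_height (P : A -> C) : ideal_M lam rho W0 Delta P ->
  exists2 Q, poly_fun_inv lam rho W0 Q & forall x, P x = Q x * height x.
Proof.
case=> [[[p pP] Pinv] PM].
have [q pE] := shear_congr height_poly (fun i => unit0 i / d ord0) p.
(* The sheared part of [p] is [P] composed with [proj], which vanishes because [P] is 0 on M. *)
have PE x : P x = q.@[coords x] * height x.
  rewrite pP -/(coords x) {1}pE mevalD mevalM -(poly_fun_proj pP).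
  by rewrite (PM _ (proj_Mset x)) add0r -heightE mulrC.
have Qpoly : poly_fun lam rho (fun x => q.@[coords x]) by exists q.
exists (fun x => q.@[coords x]) => //; split=> // w Ww x y yx.
have [qx qxE] := poly_fun_line x Qpoly.
have [qy qyE] := poly_fun_line y Qpoly.
(* On the parallel lines through [x] and [y] the height is the same nonzero affine polynomial in
   [s], and it can be cancelled. *)
have qxy : qx = qy.
  apply: (affine_cancel (a := height x) d0) => s.
  rewrite -{2}(height_inv Ww yx) -!height_shift qxE qyE.
  by rewrite mulrC -PE mulrC -PE; apply/esym/(Pinv w Ww)/shift_inv.
have e0 z : coords z =1 coords (shift z 0).
  by move=> i; rewrite coords_shift mul0r addr0.
by rewrite (meval_eq _ (e0 x)) (meval_eq _ (e0 y)) -qxE -qyE qxy.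
Qed.

Lemma tau_invariant_ideal_M0 (P : A -> C) : poly_fun_inv_tau lam rho W0 P ->
  ideal_M lam rho W0 Delta P -> P = fun=> 0.
Proof.
move=> [[Ppoly _] Ptau] [_ PM]; apply: funext => x.
have [q qE] := poly_fun_line (proj x) Ppoly.
(* Tau-invariance propagates the zero at [proj x] to all its translates by natural multiples of
   lambda_0. *)
have q0 k : P (shift (proj x) k%:R) = 0.
  elim: k => [|k IHk].
    apply: etrans (PM _ (proj_Mset x)); apply: (poly_fun_eq Ppoly).
    by rewrite sval_shift scale0r addr0.
  apply: etrans IHk; rewrite -[in LHS]Ptau; apply: (poly_fun_eq Ppoly).
  rewrite sval_translateA 2!(sval_shift (proj x)) -natr1 scalerDl scale1r.
  by rewrite addrA addrK.
have qE0 : q = 0 by apply: poly_nat_zeros => k; rewrite qE q0.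
have -> : P x = P (shift (proj x) (height x / d ord0)).
  by apply: (poly_fun_eq Ppoly); rewrite 2!sval_shift scaleNr subrK.
by rewrite -qE qE0 horner0.
Qed.

Lemma poly_fun_inv_decomposition (P : A -> C) : poly_fun_inv lam rho W0 P ->
  exists P1 P2, [/\ poly_fun_inv_tau lam rho W0 P1, ideal_M lam rho W0 Delta P2
    & P = fun x => P1 x + P2 x].
Proof.
move=> Pi; have [[p pP] Pinv] := Pi.
have Ppoly : poly_fun lam rho P by exists p.
have P1i : poly_fun_inv lam rho W0 (P \o proj).
  split; first by eexists; exact: poly_fun_proj.
  by move=> w Ww x y yx /=; apply: (Pinv w Ww); apply: proj_inv.
(* The second summand vanishes on M because [proj] fixes the points of M. *)
exists (P \o proj), (fun x => P x + (- 1) * (P \o proj) x); split.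
- split=> //; apply: funext => x; apply: (poly_fun_eq Ppoly).
  have hx : height (translateA x) = height x - d ord0.
    have -> : height x - d ord0 = height (shift x (- 1)).
      by rewrite height_shift mulN1r.
    by rewrite /height /= scaleN1r.
  rewrite /proj 2!sval_shift sval_translateA hx.
  exact: translate_projE.
- split; first exact: poly_fun_invD.
  move=> x; rewrite /Mset /= -/(height x) => hx; apply/eqP.
  rewrite mulN1r subr_eq0; apply/eqP/(poly_fun_eq Ppoly).
  by rewrite sval_shift hx mul0r oppr0 scale0r addr0.
- by apply: funext => x; rewrite mulN1r addrC subrK.
Qed.

Lemma direct_sum_ideal_M : direct_sum (poly_fun_inv lam rho W0)
  (poly_fun_inv_tau lam rho W0) (ideal_M lam rho W0 Delta).
Proof.
have z0 : poly_fun_inv lam rho W0 (fun=> 0).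
  by split=> //; exists 0 => x; rewrite meval0.
split; apply/seteqP; split=> P /=.
- exact: poly_fun_inv_decomposition.
- case=> P1 [P2 [[P1i _] [P2i _] ->]].
  have := poly_fun_invD 1 P1i P2i.
  by under eq_fun do rewrite mul1r.
- by case=> P1 P2; rewrite (tau_invariant_ideal_M0 P1 P2).
- by move=> ->; split; split.
Qed.

End Affine.

(** * The polynomial of the Euler operator and the theorem *)

(** Both sides are polynomial in [v], so natural exponents suffice; there the Euler operator is
    applied to the generator of V_a. *)
Lemma b_function_euler (R : realType) (m n r : nat) (G : set 'M[R[i]]_m)
    (pi : 'M[R[i]]_m -> 'M[R[i]]_n) (Delta : 'I_r.+1 -> {mpoly R[i][n]})
    (b : ({mpoly R[i][n]} -> {mpoly R[i][n]}) -> {mpoly R[i][r.+1]}) :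
    diff_op_inv G pi (@euler R n) -> is_b_function G pi Delta b ->
    (forall i, Delta i != 0) ->
  forall v, (b (@euler R n)).@[v] = \sum_i v i * (msize (Delta i)).-1%:R.
Proof.
move=> Einv Hb nD v.
have lE u : (\sum_i (msize (Delta i)).-1%:R *: 'X_i : {mpoly R[i][r.+1]}).@[u] =
    \sum_i u i * (msize (Delta i)).-1%:R.
  by rewrite raddf_sum; apply: eq_bigr => i _ /=; rewrite mevalZ mevalXU mulrC.
rewrite -lE; apply/eqP; rewrite -subr_eq0 -mevalB; apply/eqP.
apply: mpoly_nat_zeros => a; rewrite mevalB lE; apply/eqP; rewrite subr_eq0.
apply/eqP; apply: (euler_prod_eigenvalue nD).
by apply: (Hb _ Einv a) => S _ _.
Qed.

Theorem lemma3p2p5 (R : realType) (m n r : nat)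
    (G B : set 'M[R[i]]_m) (pi : 'M[R[i]]_m -> 'M[R[i]]_n)
    (t : {vspace 'M[R[i]]_m})
    (Delta : 'I_r.+1 -> {mpoly R[i][n]})
    (chi : 'I_r.+1 -> 'M[R[i]]_m -> R[i])
    (lam : (r.+1).-tuple (tdual t))
    (b : ({mpoly R[i][n]} -> {mpoly R[i][n]}) -> {mpoly R[i][r.+1]})
    (W0 : set 'End(tdual t)) :
  let rho := half_sum_positive G B t in
  let h := h_of lam rho b in
  let CAW0 := poly_fun_inv lam rho W0 in
  let CAW0tau := poly_fun_inv_tau lam rho W0 in
  let IM := ideal_M lam rho W0 Delta in
  forall
    (HG : algebraic_group G)
    (Gconnected : zariski_connected G)
    (Greductive : reductive G)
    (Hpi : rational_rep G pi)
    (GV_multiplicity_free : multiplicity_free G pi)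
    (GV_one_dim_quotient : one_dim_quotient G pi)
    (HB : borel_subgroup G B)
    (Ht : cartan_subalgebra (lie_algebra G) t)
    (t_sub_b : forall X, X \in t -> lie_algebra B X)
    (HDelta : fundamental_rel_invariants pi B Delta chi)
    (HDelta0 : forall i,
       (exists eta, rel_invariant pi G eta (Delta i)) <-> i = ord0)
    (Hlam : forall i, is_inf_character B (chi i) (tnth lam i))
    (lam_free : free lam)
    (Hb : is_b_function G pi Delta b)
    (W0_finite : finite_set W0)
    (W0_subgroup : subgroup_End W0)
    (W0_sub_W : W0 `<=` weyl_group G t)
    (W0_stab_A : forall w, W0 w -> stabilizes_A lam rho w)
    (Knop : algebra_isomorphism (diff_op_inv G pi) CAW0 h),
  IM = [set P | exists2 Q, CAW0 Q & P = (fun x => Q x * h (@euler R n) x)]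
  /\ direct_sum CAW0 CAW0tau IM.


Proof.
move=> rho h CAW0 CAW0tau IM [HG _] _ _ Hpi _ _.
move=> [BG [[Bgrp _] _ _] _] _ t_sub_b [Dirr Brel _] HDelta0 Hlam lam_free.
move=> Hb _ _ W0_sub_W _ [[hfun _ _] _ _ _].
have nD i : Delta i != 0 by have [] := Dirr i.
have d0 : (msize (Delta ord0)).-1%:R != 0 :> R[i].
  by rewrite pnatr_eq0; have [_ nu _] := Dirr ord0; apply: nonunit_degree_neq0.
have [eta Geta] := (HDelta0 ord0).2 erefl.
have W0_fix w : W0 w -> w (lam0 lam) = lam0 lam.
  move=> /W0_sub_W; apply: weyl_group_fix => alpha H.
  exact: (inf_character_coroot0 HG Hpi Bgrp BG t_sub_b (nD ord0) Geta
    (Brel ord0) (Hlam ord0)).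
have Einv := diff_op_inv_euler HG Hpi.
(* The sign comes from [h_of], which evaluates at rho - x, whereas the height uses x - rho. *)
have hE x : h (@euler R n) x = - height Delta x.
  rewrite /h /h_of (b_function_euler Einv Hb nD) /height /mu -sumrN.
  by apply: eq_bigr => i _; rewrite -opprB linearN mulNr.
(* Knop's isomorphism places h(E) in C[A]^W0, which gives the invariance of the height. *)
have [Epoly Einv0] := hfun _ Einv.
have height_inv w : W0 w -> forall x y : Aspace lam rho,
    sval y = w (sval x) -> height Delta y = height Delta x.
  by move=> Ww x y /(Einv0 w Ww); rewrite !hE => /oppr_inj.
split; last exact: direct_sum_ideal_M lam_free d0 W0_fix height_inv.
apply/seteqP; split=> P.
  move=> /(ideal_M_height lam_free d0 W0_fix height_inv)[Q Qi PE].
  (* The cofactor of h(E) is the opposite of that of the height, in the form required by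
     [poly_fun_invD]. *)
  exists (fun x => 0 + (- 1) * Q x).
    by apply: poly_fun_invD Qi; split=> //; exists 0 => x; rewrite meval0.
  by apply: funext => x; rewrite PE hE add0r mulN1r mulrNN.
case=> Q [[q qE] Qi] ->; split; first split.
- have [e eE] := Epoly.
  by exists (q * e) => x; rewrite qE eE mevalM.
- by move=> w Ww x y yx; rewrite (Qi w Ww x y yx) (Einv0 w Ww x y yx).
- move=> x; rewrite hE => hx.
  have -> : height Delta x = 0 by exact: hx.
  by rewrite oppr0 mulr0.
Qed.
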